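(* Let $h_1,\dots,h_K:\mathbb{R}\to\mathbb{R}$ be measurable functions and let $s_k(\mu)=\mathbb{E}_{Z\sim\mu}[h_k(Z)]$, $k=1,\dots,K$. If the set of statistics $\{s_1,\dots,s_K\}$ is Bellman closed, then there exists $L\le K$ such that the linear span of the functionals $\{s_0,s_1,\dots,s_K\}$ equals the linear span of the moment functionals $\{\mu\mapsto \mathbb{E}_{Z\sim\mu}[Z^l] : l=0,1,\dots,L\}$, where $s_0$ denotes the constant functional $s_0(\mu)=1$.
   Context: MDP setting: a Markov decision process has finite state space $\mathcal X$, finite action space $\mathcal A$, transition kernel $p(\cdot\mid x,a)$, discount factor $\gamma\in[0,1)$, and reward distributions $\mathcal R(\cdot\mid x,a)$ on $\mathbb{R}$. A (Markov) policy is a map $\pi:\mathcal X\to\mathscr P(\mathcal A)$. Given $X_0=x,A_0=a$, the trajectory is generated by $R_t\sim\mathcal R(\cdot\mid X_t,A_t)$, $X_{t+1}\sim p(\cdot\mid X_t,A_t)$, $A_{t+1}\sim\pi(\cdot\mid X_{t+1})$, and the return distribution $\eta^\pi(x,a)$ is the law of $\sum_{t\ge0}\gamma^tR_t$. A statistic is a map $s$ from (a subset of) the set of probability distributions on $\mathbb{R}$ to $\mathbb{R}$; statistics of the form $\mathbb{E}[h(Z)]$ are defined on those distributions for which the expectation is finite, and only MDPs whose return distributions lie in this domain are considered. Bellman closedness: a finite set of statistics $\{s_1,\dots,s_K\}$ is Bellman closed if the values $s_{1:K}(\eta^\pi(x,a))$ can be expressed in an MDP-independent manner in terms of $\gamma$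 and the joint law of the random variables $R_0$ and $s_{1:K}(\eta^\pi(X_1,A_1))$ conditional on $X_0=x,A_0=a$; i.e. for each $\gamma\in[0,1)$ there is a single map $G_\gamma$ such that for every MDP with discount $\gamma$, every policy $\pi$ and every $(x,a)\in\mathcal X\times\mathcal A$, $s_{1:K}(\eta^\pi(x,a))=G_\gamma\big(\mathrm{Law}(R_0, s_{1:K}(\eta^\pi(X_1,A_1))\mid X_0=x,A_0=a)\big)$. *)

(* Defs.v *)
From HB Require Import structures.
From mathcomp Require Import all_boot all_order all_algebra.
From mathcomp Require Import all_classical all_reals all_analysis.
Unset Printing Implicit Defensive.
Import Order.TTheory GRing.Theory Num.Theory.
Import numFieldNormedType.Exports.
Local Open Scope classical_set_scope.
Local Open Scope ring_scope.

Definition stochastic_row {R : realType} {T : finType} (q : T -> R) : Prop :=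
  (forall t, 0 <= q t) /\ \sum_(t : T) q t = 1.

Record realization (R : realType) (X A : finType) := Realization {
  rz_disp : measure_display;
  rz_Omega : measurableType rz_disp;
  rz_P : probability rz_Omega R;
  rz_X : nat -> rz_Omega -> X;
  rz_A : nat -> rz_Omega -> A;
  rz_R : nat -> rz_Omega -> R }.
Arguments rz_disp {R X A}.
Arguments rz_Omega {R X A}.
Arguments rz_P {R X A}.
Arguments rz_X {R X A}.
Arguments rz_A {R X A}.
Arguments rz_R {R X A}.

(* probability of the cylinder event
   {X_t = xs t, A_t = as_ t, R_t in Bs t for all t <= n}
   for the trajectory started at X_0 = x, A_0 = a *)
Definition cyl_prob {R : realType} {X A : finType}
  (p : X -> A -> X -> R) (pi : X -> A -> R) (Rw : X -> A -> probability R R)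
  (x : X) (a : A) (n : nat) (xs : nat -> X) (as_ : nat -> A) (Bs : nat -> set R) : R :=
  (xs 0%N == x)%:R * (as_ 0%N == a)%:R *
  (\prod_(t < n) (fine (Rw (xs t) (as_ t) (Bs t)) * p (xs t) (as_ t) (xs t.+1)
                  * pi (xs t.+1) (as_ t.+1))) *
  fine (Rw (xs n) (as_ n) (Bs n)).

(* rz is the trajectory generated by (p, pi, Rw) from X_0 = x, A_0 = a:
   R_t ~ Rw(.|X_t,A_t), X_{t+1} ~ p(.|X_t,A_t), A_{t+1} ~ pi(.|X_{t+1}).
   (the finite-dimensional distributions are prescribed on all cylinders) *)
Definition is_trajectory {R : realType} {X A : finType}
  (p : X -> A -> X -> R) (pi : X -> A -> R) (Rw : X -> A -> probability R R)
  (x : X) (a : A) (rz : realization R X A) : Prop :=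
  (forall t y, measurable (rz_X rz t @^-1` [set y])) /\
  (forall t b, measurable (rz_A rz t @^-1` [set b])) /\
  (forall t, measurable_fun setT (rz_R rz t)) /\
  (forall n xs as_ (Bs : nat -> set R), (forall t, measurable (Bs t)) ->
     rz_P rz (\bigcap_(t in [set t | (t <= n)%N])
                [set w | rz_X rz t w = xs t /\ rz_A rz t w = as_ t /\ Bs t (rz_R rz t w)])
     = (cyl_prob p pi Rw x a n xs as_ Bs)%:E).

Definition partial_return {R : realType} {X A : finType} (gamma : R)
  (rz : realization R X A) (w : rz_Omega rz) (n : nat) : R :=
  \sum_(t < n) gamma ^+ t * rz_R rz t w.
Arguments partial_return {R X A} gamma rz w n.

Definition return_rv {R : realType} {X A : finType} (gamma : R)
  (rz : realization R X A) (w : rz_Omega rz) : R :=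
  limn (partial_return gamma rz w).
Arguments return_rv {R X A} gamma rz w.

Definition return_converges {R : realType} {X A : finType} (gamma : R)
  (rz : realization R X A) : Prop :=
  {ae rz_P rz, forall w, cvgn (partial_return gamma rz w)}.

Definition stat_of_return {R : realType} {X A : finType} {K : nat} (gamma : R)
  (h : 'I_K -> R -> R) (rz : realization R X A) (k : 'I_K) : R :=
  Rintegral (rz_P rz) setT (fun w => h k (return_rv gamma rz w)).

(* The joint law of (R_0, V(X_1, A_1)), where V : X -> A -> R^K, represented by
   its values on measurable rectangles B0 x B_1 x ... x B_K (which determine it). *)
Definition joint_law {R : realType} {X A : finType} {K : nat}
  (rz : realization R X A) (V : X -> A -> 'I_K -> R) :
  set R -> ('I_K -> set R) -> R :=
  fun B0 Bs =>
    if `[< measurable B0 /\ forall k, measurable (Bs k) >] then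
      fine (rz_P rz [set w | B0 (rz_R rz 0%N w) /\
                             forall k, Bs k (V (rz_X rz 1%N w) (rz_A rz 1%N w) k)])
    else 0.

Definition bellman_closed {R : realType} {K : nat} (h : 'I_K -> R -> R) : Prop :=
  forall gamma : R, 0 <= gamma < 1 ->
  exists G : (set R -> ('I_K -> set R) -> R) -> ('I_K -> R),
  forall (X A : finType) (p : X -> A -> X -> R) (pi : X -> A -> R)
         (Rw : X -> A -> probability R R),
    (forall x a, stochastic_row (p x a)) ->
    (forall x, stochastic_row (pi x)) ->
  forall rz : X -> A -> realization R X A,
    (forall x a, is_trajectory p pi Rw x a (rz x a)) ->
    (forall x a, return_converges gamma (rz x a)) ->
    (forall x a k, (rz_P (rz x a)).-integrable setT
                     (fun w => (h k (return_rv gamma (rz x a) w))%:E)) ->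
  forall x a,
    (fun k => stat_of_return gamma h (rz x a) k)
    = G (joint_law (rz x a) (fun x' a' k => stat_of_return gamma h (rz x' a') k)).

Definition stat_dom {R : realType} {K : nat} (h : 'I_K -> R -> R) (L : nat) :=
  {mu : probability R R |
     (forall k, mu.-integrable setT (fun z => (h k z)%:E)) /\
     (forall l, (l <= L)%N -> mu.-integrable setT (fun z => (z ^+ l)%:E))}.

Definition fspan {R : realType} {D : Type} {n : nat} (F : 'I_n -> D -> R) : set (D -> R) :=
  [set f | exists c : 'I_n -> R, f = fun mu => \sum_(i < n) c i * F i mu].

(* s_0 = 1, s_k(mu) = E_mu[h_k]  (k = 1..K, index k is 'I_K shifted by one) *)
Definition stat_funs {R : realType} {K : nat} (h : 'I_K -> R -> R) (L : nat) :
  'I_K.+1 -> stat_dom h L -> R :=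
  fun i mu => match unlift ord0 i with
              | None => 1
              | Some k => Rintegral (sval mu) setT (h k)
              end.

Definition moment_funs {R : realType} {K : nat} (h : 'I_K -> R -> R) (L : nat) :
  'I_L.+1 -> stat_dom h L -> R :=
  fun l mu => Rintegral (sval mu) setT (fun z => z ^+ l).

(* Main.v *)
Require Import Defs.
From HB Require Import structures.
From mathcomp Require Import all_boot all_order all_algebra.
From mathcomp Require Import all_classical all_reals all_analysis.
From mathcomp Require Import measurable_realfun.
From mathcomp Require Import ring lra.
Import Order.TTheory GRing.Theory Num.Theory.
Import numFieldNormedType.Exports.
Local Open Scope classical_set_scope.
Local Open Scope ring_scope.
Set Implicit Arguments.
Unset Strict Implicit.

(**
Let phi = (1, h_1, ..., h_K). Running the chain "reward r, then reward Z ~ mu, then 0" with finitely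
supported mu, Bellman closedness says that the linear relations among the vectors phi(z) are
preserved by z |-> r + g z for 0 < g < 1. Hence V = span(1, h_1, ..., h_K) is mapped into itself by
composition with these contractions and, being finite-dimensional, by composition with every
z |-> r + b z with b > 0.

If dim V = m, the evaluations at 0, 1, ..., m are linearly dependent on V, so affine invariance yields
a fixed nonzero chi with sum_k chi_k f(x + k b) = 0 for all f in V, all x and all b > 0. Eliminating
the terms one after another shows that all m-fold differences of f vanish. A Steinhaus argument shows
that measurability and finite dimension make V locally bounded, so by Frechet's theorem V consists of
polynomials of degree < m. Differences lower the degree by exactly one, hence V contains all monomials
up to its maximal degree L.
*)

(** * Finite differences and polynomials *)

Definition fdiff {R : realType} (t : R) (f : R -> R) : R -> R :=
  fun x => f (x + t) - f x.

(** The [n] steps are independent of one another: this is Frechet's functional equation. *)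
Fixpoint diff_null {R : realType} (n : nat) (f : R -> R) : Prop :=
  match n with
  | 0 => forall x, f x = 0
  | n'.+1 => forall t, diff_null n' (fdiff t f)
  end.

(* polynomial functions of degree strictly less than n *)
Fixpoint is_pol {R : realType} (n : nat) (f : R -> R) : Prop :=
  match n with
  | 0 => forall x, f x = 0
  | n'.+1 => exists a, is_pol n' (fun x => f x - a * x ^+ n')
  end.

Definition locally_bounded {R : realType} (f : R -> R) : Prop :=
  forall M : R, exists N : R, forall x, `|x| <= M -> `|f x| <= N.

Section Differences.
Variable R : realType.
Implicit Types (f g : R -> R) (n : nat).

Lemma diff_null_ext n f g : f =1 g -> diff_null n f -> diff_null n g.
Proof. by move=> /funext ->. Qed.

Lemma is_pol_ext n f g : f =1 g -> is_pol n f -> is_pol n g.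
Proof. by move=> /funext ->. Qed.

Lemma diff_null_lin n (a : R) f g :
  diff_null n f -> diff_null n g -> diff_null n (fun x => a * f x + g x).
Proof.
elim: n f g => [|n IH] f g /= hf hg; first by move=> x; rewrite hf hg; ring.
move=> t; apply: diff_null_ext (IH _ _ (hf t) (hg t)) => x; rewrite /fdiff; ring.
Qed.

Lemma diff_null0 n : diff_null n (fun=> 0 : R).
Proof.
elim: n => [|n IH] //= t; apply: diff_null_ext IH => x; by rewrite /fdiff subrr.
Qed.

Lemma diff_nullZ n (a : R) f : diff_null n f -> diff_null n (fun x => a * f x).
Proof.
move=> hf; apply: diff_null_ext (diff_null_lin a hf (diff_null0 n)) => x.
by rewrite addr0.
Qed.

Lemma diff_nullB n f g :
  diff_null n f -> diff_null n g -> diff_null n (fun x => f x - g x).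
Proof.
move=> hf hg; apply: diff_null_ext (diff_null_lin (-1) hg hf) => x.
by rewrite mulN1r addrC.
Qed.

Lemma diff_null_shift n (s : R) f :
  diff_null n f -> diff_null n (fun x => f (x + s)).
Proof.
elim: n f => [|n IH] f /= hf; first by move=> x; apply: hf.
move=> t; apply: diff_null_ext (IH _ (hf t)) => x.
by rewrite /fdiff addrAC.
Qed.

(** The difference with step [-t] is minus the difference with step [t], translated by [-t], so
    steps of one sign, that of [e], suffice. *)
Lemma diff_null_half n f (e : R) : e != 0 ->
  (forall t, 0 < t -> diff_null n (fdiff (e * t) f)) -> diff_null n.+1 f.
Proof.
move=> e0 H t.
have [-> | t0] := eqVneq t 0.
  by apply: diff_null_ext (diff_null0 n) => x; rewrite /fdiff addr0 subrr.
have [p|] := ltP 0 (t / e).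
  by have := H _ p; rewrite mulrCA divff // mulr1.
rewrite le_eqVlt mulf_eq0 (negbTE t0) invr_eq0 (negbTE e0) /= => p.
have p' : 0 < - t / e by rewrite mulNr oppr_gt0.
have := diff_null_shift t (diff_nullZ (-1) (H _ p')).
apply: diff_null_ext => x; rewrite /fdiff mulrCA divff // mulr1.
by rewrite addrK mulN1r opprB.
Qed.

Lemma is_pol_lin n (a : R) f g :
  is_pol n f -> is_pol n g -> is_pol n (fun x => a * f x + g x).
Proof.
elim: n f g => [|n IH] f g /= hf hg; first by move=> x; rewrite hf hg; ring.
case: hf => b hb; case: hg => c hc; exists (a * b + c).
apply: is_pol_ext (IH _ _ hb hc) => x /=; ring.
Qed.

Lemma is_pol0 n : is_pol n (fun=> 0 : R).
Proof.
elim: n => [|n IH] //=; exists 0; apply: is_pol_ext IH => x.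
by rewrite mul0r subr0.
Qed.

Lemma is_polZ n (a : R) f : is_pol n f -> is_pol n (fun x => a * f x).
Proof.
move=> hf; apply: is_pol_ext (is_pol_lin a hf (is_pol0 n)) => x.
by rewrite addr0.
Qed.

Lemma is_polD n f g :
  is_pol n f -> is_pol n g -> is_pol n (fun x => f x + g x).
Proof.
move=> hf hg; apply: is_pol_ext (is_pol_lin 1 hf hg) => x.
by rewrite mul1r.
Qed.

Lemma is_polS n f : is_pol n f -> is_pol n.+1 f.
Proof. by exists 0; apply: is_pol_ext H => x; rewrite mul0r subr0. Qed.

Lemma is_polW m n f : (m <= n)%N -> is_pol m f -> is_pol n f.
Proof.
by move=> /subnK <-; elim: (n - m)%N => //= k IH /IH; apply: is_polS.
Qed.

Lemma is_pol_sum n (c : nat -> R) : is_pol n (fun x => \sum_(i < n) c i * x ^+ i).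
Proof.
elim: n => [|n IH] /=; first by move=> x; rewrite big_ord0.
by exists (c n); apply: is_pol_ext IH => x; rewrite big_ord_recr /= addrK.
Qed.

Lemma is_polP n f :
  is_pol n f -> exists c : nat -> R, forall x, f x = \sum_(i < n) c i * x ^+ i.
Proof.
elim: n f => [|n IH] f /=; first by move=> h; exists (fun=> 0) => x; rewrite big_ord0.
move=> [a /IH [c hc]]; exists (fun i => if i == n then a else c i) => x.
rewrite big_ord_recr /= eqxx -[LHS](subrK (a * x ^+ n)) hc; congr (_ + _).
by apply: eq_bigr => i _; rewrite (ltn_eqF (ltn_ord i)).
Qed.

(** Binomial theorem: the top term cancels, the term of index [n] is subtracted, and the terms of
    index below [n] remain. *)
Lemma diff_exprS n (t : R) :
  is_pol n (fun x => fdiff t (fun y => y ^+ n.+1) x - n.+1%:R * t * x ^+ n).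
Proof.
apply: is_pol_ext (is_pol_sum n (fun i => t ^+ (n.+1 - i) *+ 'C(n.+1, i))) => x.
rewrite /fdiff addrC [x + t]addrC exprDn 2!big_ord_recr /= subnn subSnn binn.
rewrite expr0 mul1r mulr1n expr1 -bin_sub // subSnn bin1 addrK.
rewrite -[t * _ *+ _]mulr_natl mulrA addrC addrK.
by apply: eq_bigr => i _; rewrite mulrnAl.
Qed.

Lemma is_pol_diff n (t : R) f : is_pol n.+1 f -> is_pol n (fdiff t f).
Proof.
elim: n f => [|n IH] f [a].
  by move=> /= h x; rewrite /fdiff -[f (x + t)](subrK (a * (x + t) ^+ 0)) h
    -[f x](subrK (a * x ^+ 0)) h !expr0 subrr.
move=> /IH h /=; exists (a * (n.+1%:R * t)).
apply: is_pol_ext (is_polD h (is_polZ a (diff_exprS n t))) => x.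
rewrite /fdiff; ring.
Qed.

Lemma is_pol_diff_null n f : is_pol n f -> diff_null n f.
Proof.
elim: n f => [|n IH] f // hf t; apply: IH; exact: is_pol_diff.
Qed.

Lemma iter_diff_ext n (f g : R -> R) : f =1 g ->
  iter n (fdiff 1) f =1 iter n (fdiff 1) g.
Proof. by move=> /funext ->. Qed.

Lemma iter_diff_lin n (a : R) f g x :
  iter n (fdiff 1) (fun x => a * f x + g x) x =
  a * iter n (fdiff 1) f x + iter n (fdiff 1) g x.
Proof. elim: n x => //= n IH x; rewrite {1}/fdiff !IH /fdiff; ring. Qed.

Lemma iter_diff_null n f x : diff_null n f -> iter n (fdiff 1) f x = 0.
Proof. by elim: n f => [|n IH] f hf; [apply: hf | rewrite iterSr; apply: IH]. Qed.

Lemma iter_diff_X n x : iter n (fdiff 1) (fun y : R => y ^+ n) x = n`!%:R.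
Proof.
elim: n => [|n IH]; first by rewrite /= expr0.
rewrite iterSr; pose g := fun y => fdiff 1 (fun z : R => z ^+ n.+1) y - n.+1%:R * 1 * y ^+ n.
transitivity (iter n (fdiff 1) (fun y => n.+1%:R * y ^+ n + g y) x).
  by apply: iter_diff_ext => y; rewrite /g; ring.
rewrite iter_diff_lin IH iter_diff_null ?addr0 ?factS ?natrM//.
exact: is_pol_diff_null (diff_exprS n 1).
Qed.

(** An [n]-fold difference at [x] only sees [x, x + 1, ..., x + n], with weights of total absolute
    value [2 ^+ n]. *)
Lemma iter_diff_bound n f (M N x : R) :
  (forall y, `|y| <= M -> `|f y| <= N) -> `|x| + n%:R <= M ->
  `|iter n (fdiff 1) f x| <= 2 ^+ n * N.
Proof.
move=> hN; elim: n x => [|n IH] x /=; first by rewrite addr0 mul1r; apply: hN.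
rewrite -natr1 => hx; rewrite /fdiff (le_trans (ler_normB _ _)) // exprS -mulrA mulr_natl mulr2n.
apply: lerD; apply: IH; last by lra.
by have := ler_normD x 1; rewrite normr1; lra.
Qed.

Lemma locally_bounded_diff (t : R) f : locally_bounded f -> locally_bounded (fdiff t f).
Proof.
move=> hf M; have [N hN] := hf (M + `|t|); exists (N + N) => x hx.
rewrite (le_trans (ler_normB _ _)) // lerD // hN //.
  by rewrite (le_trans (ler_normD _ _)) // lerD2r.
by rewrite (le_trans hx) // lerDl.
Qed.

Lemma locally_bounded_subX (a : R) n f :
  locally_bounded f -> locally_bounded (fun x => f x - a * x ^+ n).
Proof.
move=> hf M; have [N hN] := hf M; exists (N + `|a| * `|M| ^+ n) => x hx.
rewrite (le_trans (ler_normB _ _)) // lerD ?hN // normrM normrX.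
rewrite ler_wpM2l // lerXn2r ?nnegrE // (le_trans hx) // ler_norm //.
Qed.

(** The deviation [g] of [c] from linearity is additive and bounded on the whole line; since
    [g (n * t) = n * g t], it must vanish. *)
Lemma additive_bounded_linear (c : R -> R) (N : R) :
  (forall s t, c (s + t) = c s + c t) -> (forall t, `|t| <= 1 -> `|c t| <= N) ->
  forall t, c t = c 1 * t.
Proof.
move=> addc bc t; pose g x := c x - c 1 * x.
have addg x y : g (x + y) = g x + g y by rewrite /g addc; ring.
have gn n x : g (n%:R * x) = n%:R * g x.
  elim: n => [|n IH]; last by rewrite -natr1 !mulrDl !mul1r addg IH.
  by rewrite !mul0r; apply: (addrI (g 0)); rewrite addr0 -addg addr0.
have g1 : g 1 = 0 by rewrite /g mulr1 subrr.
have gN x : g (- x) = - g x.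
  by apply/eqP; rewrite -addr_eq0 -addg addNr; have := gn 0%N 0; rewrite !mul0r => ->.
have gz (m : int) : g m%:~R = 0.
  case: m => m; first by rewrite -[_%:~R]/(m%:R) -[m%:R]mulr1 gn g1 mulr0.
  by rewrite NegzE mulrNz gN -[_%:~R]/(m.+1%:R) -[m.+1%:R]mulr1 gn g1 mulr0 oppr0.
(* As [g] is additive and zero on integers, it has period 1 and is bounded by its values on [[0,
   1[]. *)
have gb x : `|g x| <= N + `|c 1|.
  rewrite -[x](subrK (Num.floor x)%:~R) addg gz addr0.
  set y := x - _; have y01 : 0 <= y < 1.
    by have := floor_itv x; rewrite /y intrD => /andP[]; lra.
  have y1 : `|y| <= 1 by rewrite ger0_norm; lra.
  rewrite /g (le_trans (ler_normB _ _)) // lerD ?bc // normrM.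
  by rewrite -[leRHS]mulr1 ler_wpM2l.
suff : g t = 0 by rewrite /g => /eqP; rewrite subr_eq0 => /eqP.
apply/eqP; rewrite -normr_eq0 eq_le normr_ge0 andbT leNgt; apply/negP => gt0.
have [n hn] : exists n : nat, (N + `|c 1|) / `|g t| < n%:R.
  exists (Num.truncn ((N + `|c 1|) / `|g t|)).+1; exact: truncnS_gt.
have := gb (n%:R * t); rewrite gn normrM normr_nat leNgt => /negP; apply.
by rewrite -ltr_pdivrMr.
Qed.

(** By induction each [fdiff t f] has a leading coefficient [c t]. It is additive and bounded near
    0, hence linear in [t], and a top term with coefficient [c 1 / n.+1%:R] has the same differences
    to leading order. *)
Lemma diff_null_lead n f : diff_null n.+1 f -> locally_bounded f ->
  exists c, diff_null n (fun x => f x - c * x ^+ n).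
Proof.
elim: n f => [|n IH] f hf bf.
  exists (f 0) => x; rewrite expr0 mulr1 -{1}[x]add0r; exact: hf.
have /choice [c hc] : forall t, exists c, diff_null n (fun x => fdiff t f x - c * x ^+ n).
  by move=> t; apply: IH (hf t) _; apply: locally_bounded_diff.
have uniq (a : R) : diff_null n (fun x : R => a * x ^+ n) -> a = 0.
  move=> h; have : iter n (fdiff 1) (fun x : R => a * x ^+ n + 0) 0 = 0.
    by rewrite -[RHS](iter_diff_null 0 h); apply: iter_diff_ext => x; rewrite addr0.
  rewrite iter_diff_lin iter_diff_X iter_diff_null ?addr0; last exact: diff_null0.
  by move/eqP; rewrite mulf_eq0 pnatr_eq0 -leqn0 leqNgt fact_gt0 orbF => /eqP.
(* [fdiff (s + t) f - fdiff s f - fdiff t f] is the second difference [fdiff t (fdiff s f)], one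
   order lower. *)
have addc s t : c (s + t) = c s + c t.
  apply/eqP; rewrite -subr_eq0 opprD addrA -opprB oppr_eq0; apply/eqP/uniq.
  have h1 := diff_nullB (diff_nullB (hc (s + t)) (hc s)) (hc t).
  apply: diff_null_ext (diff_nullB h1 (hf s t)) => x; rewrite /fdiff.
  rewrite -(addrA x t s) (addrC t s); ring.
have [N hN] := bf (n%:R + 1).
(* [c t] times the factorial of [n] is the [n]-fold difference of [fdiff t f] at 0, and the
   factorial is at least 1. *)
have bc t : `|t| <= 1 -> `|c t| <= 2 ^+ n * (N + N).
  move=> t1.
  have /(iter_diff_bound (x := 0)) : forall y, `|y| <= n%:R -> `|fdiff t f y| <= N + N.
    move=> y hy; rewrite (le_trans (ler_normB _ _)) // lerD ?hN //; last by lra.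
    by rewrite (le_trans (ler_normD _ _)) // lerD.
  move=> /(_ n); rewrite normr0 add0r lexx => /(_ isT); apply: le_trans.
  have -> : iter n (fdiff 1) (fdiff t f) 0 = c t * n`!%:R.
    transitivity (iter n (fdiff 1) (fun x => c t * x ^+ n + (fdiff t f x - c t * x ^+ n)) 0).
      by apply: iter_diff_ext => x; rewrite addrC subrK.
    by rewrite iter_diff_lin iter_diff_X iter_diff_null ?addr0.
  by rewrite normrM normr_nat ler_peMr // ler1n fact_gt0.
have clin := additive_bounded_linear addc bc.
exists (c 1 / n.+1%:R) => t.
have h := is_pol_diff_null (diff_exprS n t).
apply: diff_null_ext (diff_nullB (hc t) (diff_nullZ (c 1 / n.+1%:R) h)) => x.
rewrite /fdiff clin; set u := n.+1%:R; have u0 : u != 0 by rewrite pnatr_eq0.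
by field.
Qed.

Lemma frechet_bounded n f : diff_null n f -> locally_bounded f -> is_pol n f.
Proof.
elim: n f => [|n IH] f hf bf //.
have [c hc] := diff_null_lead hf bf; exists c; apply: IH hc _.
exact: locally_bounded_subX.
Qed.

(* Replacing (x, b) by (x - j h, b + h) fixes the argument x + j b, so subtracting removes the j-th term. *)
Lemma diff_null_of_relation (k0 : nat) (s : seq nat) (f0 : R -> R) (f : nat -> R -> R) :
  k0 \notin s ->
  (forall x b, 0 < b -> f0 (x + k0%:R * b) + \sum_(k <- s) f k (x + k%:R * b) = 0) ->
  diff_null (size s) f0.
Proof.
elim: s f0 f => [|j s IH] f0 f /=.
  move=> _ H x; have := H (x - k0%:R) 1 ltr01.
  by rewrite big_nil addr0 mulr1 subrK.
rewrite inE negb_or => /andP[k0j k0s] H.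
apply: (@diff_null_half _ _ (k0%:R - j%:R)); first by rewrite subr_eq0 eqr_nat.
move=> h h0; apply: (IH _ (fun k => fdiff ((k%:R - j%:R) * h) (f k)) k0s) => x b b0.
have := H (x - j%:R * h) (b + h) (addr_gt0 b0 h0); have := H x b b0.
rewrite !big_cons => e1 e2.
have e (k : nat) : x - j%:R * h + k%:R * (b + h) = x + k%:R * b + (k%:R - j%:R) * h by ring.
move: e2; rewrite !e subrr mul0r addr0 => e2.
have := congr2 (fun u v => u - v) e2 e1; rewrite /= subrr => e3.
rewrite -[RHS]e3 /fdiff sumrB.
under [X in _ = _ + (_ + X) - _]eq_bigr do rewrite e.
ring.
Qed.

End Differences.
(** * Linear relations preserved by affine maps *)

Definition preserves_relations {T : Type} {F : fieldType} {n : nat}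
    (phi : T -> 'rV[F]_n) (g : T -> T) : Prop :=
  forall m (c : 'I_m -> F) (z : 'I_m -> T),
    \sum_i c i *: phi (z i) = 0 -> \sum_i c i *: phi (g (z i)) = 0.

(** Composition with [g] maps the span of the coordinates of [psi] into itself. *)
Definition acts_linearly {T : Type} {F : fieldType} {m : nat}
    (psi : T -> 'rV[F]_m) (g : T -> T) : Prop :=
  exists U : 'M[F]_m, forall x, psi (g x) = psi x *m U.

Section Coordinates.
Variables (T : Type) (F : fieldType).

(** Take as many points as possible with independent images under [phi]. These images form a basis
    of the span of all [phi x], and [psi] gives the coordinates in it. *)
Lemma basis_points n (phi : T -> 'rV[F]_n) :
  exists m (z : 'I_m -> T) (psi : T -> 'rV[F]_m) (C : 'M[F]_(n, m)),
    [/\ (m <= n)%N, forall x, psi x = phi x *m C,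
        forall x, phi x = psi x *m \matrix_i phi (z i)
      & forall i, psi (z i) = delta_mx 0 i].
Proof.
pose P m := `[< exists z : 'I_m -> T, row_free (\matrix_i phi (z i)) >].
have P0 : exists m, P m.
  exists 0%N; apply/asboolP; have f : 'I_0 -> T by case.
  by exists f; rewrite /row_free -leqn0 rank_leq_row.
have Pn m : P m -> (m <= n)%N.
  by move=> /asboolP[z /eqP <-]; apply: rank_leq_col.
case: (ex_maxnP P0 Pn) => m /asboolP[z freeB] maxm.
set B := \matrix_i phi (z i) in freeB *.
exists m, z, (fun x => phi x *m pinvmx B), (pinvmx B); split.
- by apply: Pn; apply/asboolP; exists z.
- by [].
(* A vector outside the row space of [B] would give [m.+1] independent images, against
   maximality. *)
- move=> x; rewrite mulmxKpV //; apply: contraT => phixB.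
  suff /maxm : P m.+1 by rewrite ltnn.
  apply/asboolP; exists (fun i => if unlift ord0 i is Some j then z j else x).
  apply: inj_row_free => v vB.
  have e : v 0 ord0 *: phi x + (\row_j v 0 (lift ord0 j)) *m B = 0.
    rewrite -[RHS]vB !mulmx_sum_row [RHS]big_ord_recl rowK unlift_none.
    congr (_ + _); apply: eq_bigr => j _; rewrite !rowK liftK mxE //.
  have v0 : v 0 ord0 = 0.
    apply/eqP; apply: contraNT phixB => v0.
    apply/submxP; exists (- (v 0 ord0)^-1 *: \row_j v 0 (lift ord0 j)).
    rewrite -scalemxAl; move/eqP: e; rewrite addrC addr_eq0 => /eqP ->.
    by rewrite scaleNr scalerN opprK scalerA mulVf // scale1r.
  move: e; rewrite v0 scale0r add0r => /eqP; rewrite mulmx_free_eq0 // => /eqP e.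
  apply/rowP => i; rewrite mxE; case: (unliftP ord0 i) => [j|] -> //.
  by move/rowP: e => /(_ j); rewrite !mxE.
- by move=> i; rewrite -[phi (z i)](rowK (fun i => phi (z i))) -/B -row_mul mulmxVp // row1.
Qed.

(** [phi x] minus its expansion in the [phi (z i)] is a vanishing combination; [g] carries it to an
    expansion of [phi (g x)] with the same coefficients. *)
Lemma preserves_acts n m (phi : T -> 'rV[F]_n) (z : 'I_m -> T)
    (psi : T -> 'rV[F]_m) (C : 'M[F]_(n, m)) (g : T -> T) :
  (forall x, psi x = phi x *m C) ->
  (forall x, phi x = psi x *m \matrix_i phi (z i)) ->
  preserves_relations phi g -> acts_linearly psi g.
Proof.
move=> hC hB hg; exists (\matrix_i psi (g (z i))) => x.
pose c (i : 'I_m.+1) := if unlift ord0 i is Some j then - psi x 0 j else 1.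
pose y (i : 'I_m.+1) := if unlift ord0 i is Some j then z j else x.
have split_sum (G : T -> T) : \sum_i c i *: phi (G (y i)) =
    phi (G x) - psi x *m \matrix_i phi (G (z i)).
  rewrite big_ord_recl {1}/c {1}/y unlift_none scale1r mulmx_sum_row -sumrN.
  by congr (_ + _); apply: eq_bigr => j _; rewrite rowK /c /y liftK scaleNr.
have /hg : \sum_i c i *: phi (y i) = 0 by rewrite (split_sum id) /= -hB subrr.
rewrite split_sum => /eqP; rewrite subr_eq0 => /eqP e.
rewrite hC e -mulmxA; congr (_ *m _); apply/row_matrixP => i.
by rewrite row_mul !rowK hC.
Qed.

Section Basis.
Variables (m : nat) (z : 'I_m -> T) (psi : T -> 'rV[F]_m).
Hypothesis psiz : forall i, psi (z i) = delta_mx 0 i.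

Lemma acts_comp f g : acts_linearly psi f -> acts_linearly psi g ->
  acts_linearly psi (f \o g).
Proof.
by move=> [U hU] [V hV]; exists (V *m U) => x /=; rewrite hU hV mulmxA.
Qed.

(** Since [f (g (z i)) = z i], the rows [psi (g (z i))] form a left inverse of [U], which is
    two-sided because the matrices are square. *)
Lemma acts_inv f g : cancel f g -> cancel g f ->
  acts_linearly psi f -> acts_linearly psi g.
Proof.
move=> fg gf [U hU]; exists (\matrix_i psi (g (z i))) => x.
have /mulmx1C e : (\matrix_i psi (g (z i))) *m U = 1%:M.
  by apply/row_matrixP => i; rewrite row_mul rowK -hU gf psiz row1.
by rewrite -[x in RHS]gf hU -mulmxA e mulmx1.
Qed.

Lemma actsE g x j : acts_linearly psi g ->
  psi (g x) 0 j = \sum_i psi x 0 i * psi (g (z i)) 0 j.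
Proof.
move=> [U hU]; rewrite hU mxE; apply: eq_bigr => i _.
by rewrite hU psiz -rowE !mxE.
Qed.

End Basis.
End Coordinates.

(** * Affine invariance and vanishing differences *)

Section Affine.
Variables (R : realType) (m : nat) (z : 'I_m -> R) (psi : R -> 'rV[R]_m).
Hypothesis psiz : forall i, psi (z i) = delta_mx 0 i.
Hypothesis contr : forall r b : R, 0 < b < 1 -> acts_linearly psi (fun x => r + b * x).

(** With [c = 1 / (b + 2)] both [c] and [c * b] lie between 0 and 1, and the map is the contraction
    [c * r + c * b * x] followed by the inverse of the contraction by [c]. *)
Lemma acts_affine (r b : R) : 0 < b -> acts_linearly psi (fun x => r + b * x).
Proof.
move=> b0; set c := (b + 2)^-1.
have c0 : 0 < c by rewrite invr_gt0; lra.
have c1 : c < 1 by rewrite invf_lt1; lra.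
have cb : 0 < c * b < 1.
  rewrite mulr_gt0 //= mulrC ltr_pdivrMr; lra.
have dil : acts_linearly psi (fun x => c^-1 * x).
  apply: (@acts_inv _ _ _ z psi psiz (fun x => 0 + c * x)).
  - by move=> x; rewrite add0r mulKf // gt_eqF.
  - by move=> x; rewrite add0r mulVKf // gt_eqF.
  - by apply: contr; rewrite c0.
have [U hU] := acts_comp dil (contr (c * r) cb).
exists U => x; rewrite -hU /=; congr psi.
by rewrite -mulrA -mulrDr mulKf // gt_eqF.
Qed.

Lemma coord_diff_null i : diff_null m (fun x => psi x 0 i).
Proof.
pose W : 'M[R]_(m.+1, m) := \matrix_k psi k%:R.
(* [m.+1] vectors in dimension [m] are dependent; the points form an arithmetic progression, so
   affine maps move them to [x + k * b]. *)
have [chi chi0 chiW] : exists2 chi : 'rV[R]_m.+1, chi != 0 & chi *m W = 0.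
  have : kermx W != 0.
    by rewrite kermx_eq0 /row_free neq_ltn ltnS rank_leq_col.
  case/rowV0Pn => chi /sub_kermxP hc h0; by exists chi.
have [k0 hk0] : exists k, chi 0 k != 0.
  apply/existsP; apply: contraNT chi0; rewrite negb_exists => /forallP h.
  by apply/eqP/rowP => k; rewrite mxE; apply/eqP; rewrite -[_ == _]negbK h.
have rel x b : 0 < b -> \sum_(k < m.+1) chi 0 k * psi (x + k%:R * b) 0 i = 0.
  move=> b0; have [U hU] := acts_affine x b0.
  have : (chi *m W *m U) 0 i = 0 by rewrite chiW mul0mx mxE.
  rewrite -mulmxA mxE => e; rewrite -[RHS]e; apply: eq_bigr => k _.
  rewrite [_%:R * b]mulrC hU; congr (_ * _).
  by rewrite -[psi k%:R](rowK (fun k : 'I_m.+1 => psi k%:R)) -row_mul [LHS]mxE.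
(* The indices other than [k0]: eliminating these [m] terms costs [m] differences. *)
pose s := [seq val k | k <- enum (predC1 k0)].
have sz : size s = m by rewrite size_map -cardE cardC1 card_ord.
have k0s : (k0 : nat) \notin s.
  by rewrite mem_map ?mem_enum ?inE ?eqxx //; apply: val_inj.
have := @diff_null_of_relation _ k0 s (fun x => chi 0 k0 * psi x 0 i)
  (fun k x => chi 0 (inord k) * psi x 0 i) k0s.
rewrite sz => elim; have {}elim : diff_null m (fun x => chi 0 k0 * psi x 0 i).
  apply: elim => x b b0; rewrite -[RHS](rel x b b0) (bigD1 k0) //= big_map.
  rewrite big_enum_cond /=; congr (_ + _).
  by apply: eq_big => k; rewrite ?andbT // inord_val.
apply: diff_null_ext (diff_nullZ (chi 0 k0)^-1 elim) => x.
by rewrite mulKf.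
Qed.
End Affine.
(** * A Steinhaus argument *)

Section Steinhaus.
Variable R : realType.
Notation mu := (@lebesgue_measure R).

Lemma measurable_shift (t : R) : measurable_fun setT (fun x : R => x + t).
Proof. by apply: measurable_funD => //; exact: measurable_cst. Qed.

Lemma lebesgue_measure_translation (t : R) (E : set R) : measurable E ->
  mu ((fun x => x + t) @^-1` E) = mu E.
Proof.
move=> mE; rewrite -[LHS]/(pushforward mu ((fun x => x + t) : _ -> measurableTypeR R) E).
apply/esym/lebesgue_measure_unique => //= [|_ _ [[a b]] _ <-].
  exact: measurable_shift.
rewrite /pushforward /=.
have -> : (fun x => x + t) @^-1` `]a, b] = `]a - t, b - t]%classic.
  by apply/seteqP; split => x /=; rewrite !in_itv /= ltrBlDr lerBrDr.
rewrite !lebesgue_measure_itv/= !lte_fin ltrD2r; case: ifP => // _.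
by rewrite -!EFinD; congr EFin; ring.
Qed.

(* Otherwise E and E - t are disjoint subsets of an interval of length 3/2, of total measure > 3/2. *)
Lemma sub_difference (E : set R) (t : R) : measurable E -> E `<=` `[0, 1] ->
  ((3%:R / 4%:R)%:E < mu E)%E -> `|t| <= 1 / 4%:R ->
  exists u v, [/\ E u, E v & t = u - v].
Proof.
move=> mE sE gE ht; pose Et := (fun x => x + t) @^-1` E.
have mEt : measurable Et.
  by rewrite -[Et]setTI; apply: measurable_shift.
apply: contrapT => h.
have disj : E `&` Et = set0.
  apply/seteqP; split => // x [Ex Ext]; apply: h.
  by exists (x + t), x; split => //; rewrite addrAC subrr add0r.
have sub : E `|` Et `<=` `[- (1 / 4%:R), 5%:R / 4%:R].
  move=> x /= [/sE|/sE] /=; rewrite !in_itv /= => /andP[]; move: ht; rewrite ler_norml => /andP[].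
    lra.
  lra.
have : (mu (E `|` Et) <= mu `[(- (1 / 4%:R))%R, (5%:R / 4%:R)%R])%E.
  by apply: le_measure; rewrite ?inE //; exact: measurableU.
have gEt : ((3%:R / 4%:R)%:E < mu Et)%E by rewrite [mu Et]lebesgue_measure_translation.
rewrite measureU // lebesgue_measure_itv /= lte_fin ifT; last by lra.
apply/negP; rewrite -ltNge; apply: le_lt_trans (lteD gE gEt).
by rewrite -!EFinD lee_fin; lra.
Qed.

(** The sublevel sets at natural heights increase to [[0, 1]], so their measures converge to 1. *)
Lemma large_sublevel (F : R -> R) : measurable_fun setT F ->
  exists N : R, measurable (`[0, 1] `&` [set y | F y <= N]) /\
   ((3%:R / 4%:R)%:E < mu (`[0%R, 1%R] `&` [set y : R | (F y <= N)%R]))%E.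
Proof.
move=> mF; pose E (n : nat) := (`[0, 1] : set R) `&` [set y | F y <= n%:R].
have mE n : measurable (E n).
  apply: (measurable_fun_le (g := cst n%:R)) => //; exact: measurable_funTS.
have cup : \bigcup_n E n = `[0, 1]%classic.
  apply/seteqP; split=> [x [n _ []] //|x x01].
  exists (Num.truncn (F x)).+1 => //; split => //=; apply/ltW; exact: truncnS_gt.
have mcup : measurable (\bigcup_n E n) by rewrite cup.
have nd : {homo E : n m / (n <= m)%N >-> (n <= m)%O}.
  move=> n m nm; apply/subsetPset => x [x01 /= h]; split => //=.
  by rewrite (le_trans h) // ler_nat.
have mu01 : mu `[0%R, 1%R] = 1%:E.
  by rewrite lebesgue_measure_itv /= lte_fin ltr01 oppr0 adde0.
have cv : (mu \o E) x @[x --> \oo] --> 1%:E.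
  by rewrite -mu01 -cup; exact: nondecreasing_cvg_mu.
have /(cv) [N _ /(_ N (leqnn N)) /= hN] : nbhs 1%:E [set y : \bar R | ((3%:R / 4%:R)%:E < y)%E].
  by apply: open_nbhs_nbhs; split; [exact: open_ereal_gt_ereal | rewrite /= lte_fin; lra].
by exists N%:R; split; [exact: mE | exact: hN].
Qed.
End Steinhaus.

(** * Local boundedness and polynomiality of the coordinates *)

Section Bounded.
Variables (R : realType) (m : nat) (z : 'I_m -> R) (psi : R -> 'rV[R]_m).
Hypothesis psiz : forall i, psi (z i) = delta_mx 0 i.
Hypothesis contr : forall r b : R, 0 < b < 1 -> acts_linearly psi (fun x => r + b * x).
Hypothesis mpsi : forall i, measurable_fun setT (fun x => psi x 0 i).

Lemma coord_bounded0 i : exists N : R, forall x, `|x| <= 1 / 4%:R -> `|psi x 0 i| <= N.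
Proof.
(* [F] dominates both factors in the expansion of [psi (u - v)]: the coordinates at [u] and the
   values at [z j - v]. The factor [1 *] gives the shape [r + b * x]. *)
pose F y := \sum_j (`|psi y 0 j| + `|psi (- y + 1 * z j) 0 i|).
have mF : measurable_fun setT F.
  apply: measurable_sum => j; apply: measurable_funD.
    by apply: measurableT_comp; [exact: normr_measurable | exact: mpsi].
  apply: measurableT_comp; first exact: normr_measurable.
  apply: (measurableT_comp (mpsi i)); apply: measurable_funD; last exact: measurable_cst.
  exact: oppr_measurable.
have [N [mE gE]] := large_sublevel mF.
exists (\sum_(j < m) N * N) => x hx.
have [|u [v [[_ /= Eu] [_ /= Ev] ->]]] := sub_difference mE _ gE hx; first exact: subIsetl.
have bound y j : F y <= N -> `|psi y 0 j| <= N /\ `|psi (- y + 1 * z j) 0 i| <= N.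
  move=> Fy; have : `|psi y 0 j| + `|psi (- y + 1 * z j) 0 i| <= F y.
    by rewrite /F (bigD1 j) //= lerDl sumr_ge0.
  have := normr_ge0 (psi y 0 j); have := normr_ge0 (psi (- y + 1 * z j) 0 i); lra.
(* translation invariance: psi(u - v) is bilinear in psi(u) and the psi(z_j - v) *)
have -> : u - v = - v + 1 * u by rewrite mul1r addrC.
rewrite (actsE psiz u i (acts_affine psiz contr (- v) ltr01)).
rewrite (le_trans (ler_norm_sum _ _ _)) // ler_sum // => j _.
rewrite normrM ler_pM //.
  by have [] := bound u j Eu.
by have [] := bound v j Ev.
Qed.

Lemma coord_locally_bounded i : locally_bounded (fun x => psi x 0 i).
Proof.
move=> M; have /choice [N hN] := coord_bounded0.
(* Division by [b] takes the ball of radius [M] into that of radius 1/4, where [coord_bounded0]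
   applies. *)
pose b := 4%:R * (`|M| + 1); have b0 : 0 < b by rewrite mulr_gt0 // ltr_wpDl.
exists (\sum_j N j * `|psi (0 + b * z j) 0 i|) => x hx.
have -> : x = 0 + b * (b^-1 * x) by rewrite add0r mulVKf // gt_eqF.
rewrite (actsE psiz _ i (acts_affine psiz contr 0 b0)).
rewrite (le_trans (ler_norm_sum _ _ _)) // ler_sum // => j _.
rewrite normrM ler_wpM2r // hN // normrM gtr0_norm ?invr_gt0 // mulrC.
rewrite ler_pdivrMr // /b mulrA divfK ?mul1r // (le_trans hx) //.
by rewrite (le_trans (ler_norm M)) // lerDl.
Qed.

Lemma coord_is_pol i : is_pol m (fun x => psi x 0 i).
Proof.
apply: frechet_bounded; last exact: coord_locally_bounded.
exact: coord_diff_null psiz contr i.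
Qed.

End Bounded.

(** The argument runs in the coordinates [psi]; fixed matrices pass between [phi] and [psi] in both
    directions, so polynomiality and invariance carry over. *)
Lemma relations_is_pol (R : realType) n (phi : R -> 'rV[R]_n) :
  (forall i, measurable_fun setT (fun x => phi x 0 i)) ->
  (forall r b : R, 0 < b < 1 -> preserves_relations phi (fun x => r + b * x)) ->
  (forall i, is_pol n (fun x => phi x 0 i)) /\
  (forall r b : R, 0 < b -> acts_linearly phi (fun x => r + b * x)).
Proof.
move=> mphi hphi; have [m [z [psi [C [mn hC hB psiz]]]]] := basis_points phi.
have contr r b : 0 < b < 1 -> acts_linearly psi (fun x => r + b * x).
  by move=> /(hphi r) hp; apply: preserves_acts hC hB hp.
have mpsi i : measurable_fun setT (fun x => psi x 0 i).
  rewrite (_ : (fun x => _) = fun x => \sum_j phi x 0 j * C j i); last first.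
    by apply/funext => x; rewrite hC mxE.
  apply: measurable_sum => j; apply: measurable_funM => //; exact: measurable_cst.
split=> [i|r b b0].
  apply: (is_polW mn).
  rewrite (_ : (fun x => _) = fun x => \sum_j psi x 0 j * phi (z j) 0 i); last first.
    by apply/funext => x; rewrite hB mxE; apply: eq_bigr => j _; rewrite mxE.
  elim: (index_enum _) => [|j s IH].
    by apply: is_pol_ext (is_pol0 R m) => x; rewrite big_nil.
  have := is_pol_lin (phi (z j) 0 i) (coord_is_pol psiz contr mpsi j) IH.
  by apply: is_pol_ext => x; rewrite big_cons mulrC.
have [U hU] := acts_affine psiz contr r b0.
exists (C *m U *m \matrix_i phi (z i)) => x.
by rewrite hB hU hC !mulmxA.
Qed.

(** * Shift-invariant spaces containing a polynomial *)

Section SpanOfPolynomials.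
Variables (R : realType) (V : set (R -> R)).
Hypothesis Vlin : forall a f g, V f -> V g -> V (fun x => a * f x + g x).
Hypothesis V0 : V (fun=> 0).
Hypothesis Vshift : forall f, V f -> V (fun x => f (x + 1)).

(** The difference with step 1 has degree one less and a nonzero leading coefficient, so induction
    yields the lower monomials; the top one is then solved for in [f]. *)
Lemma span_monomials n f (a : R) : V f -> a != 0 ->
  is_pol n (fun x => f x - a * x ^+ n) ->
  forall l, (l <= n)%N -> V (fun x => x ^+ l).
Proof.
have Vext f1 f2 : f1 =1 f2 -> V f1 -> V f2 by move=> /funext ->.
elim: n f a => [|n IH] f a Vf a0 hf l.
  rewrite leqn0 => /eqP ->; apply: (Vext _ _ _ (Vlin a^-1 Vf V0)) => x.
  by rewrite addr0; have /eqP := hf x; rewrite expr0 mulr1 subr_eq0 => /eqP ->; rewrite mulVf.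
have low : forall l, (l <= n)%N -> V (fun x => x ^+ l).
  apply: (IH (fdiff 1 f) (n.+1%:R * a)).
  - apply: (Vext _ _ _ (Vlin (-1) Vf (Vshift Vf))) => x; rewrite /fdiff; ring.
  - by rewrite mulf_neq0 // pnatr_eq0.
  apply: is_pol_ext (is_polD (is_pol_diff 1 hf) (is_polZ a (diff_exprS n 1))) => x.
  rewrite /fdiff; ring.
rewrite leq_eqVlt => /orP[/eqP ->|]; last by rewrite ltnS; exact: low.
have [c hc] := is_polP hf.
have Vg : V (fun x => f x - a * x ^+ n.+1).
  apply: (Vext (fun x => \sum_(i < n.+1) c i * x ^+ i)) => [x|]; first by rewrite hc.
  have : forall i : 'I_n.+1, V (fun x => x ^+ i) by move=> i; apply: low; rewrite -ltnS.
  elim: (index_enum _) => [|j s IHs] hV.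
    by apply: (Vext _ _ _ V0) => x; rewrite big_nil.
  by apply: (Vext _ _ _ (Vlin (c j) (hV j) (IHs hV))) => x; rewrite big_cons.
apply: (Vext _ _ _ (Vlin (- a^-1) Vg (Vlin a^-1 Vf V0))) => x.
by rewrite addr0; field.
Qed.

End SpanOfPolynomials.
(** * The Markov chain *)

Section FiniteMixture.
Variable R : realType.

(** The law is the sum of [w k] times the point mass at [z k]; finite support makes every measurable
    function integrable. *)
Lemma finite_mixture n (w z : nat -> R) :
  (forall k, 0 <= w k) -> \sum_(k < n) w k = 1 ->
  exists P : probability R R, forall g : R -> R, measurable_fun setT g ->
    P.-integrable setT (EFin \o g) /\
    Rintegral P setT g = \sum_(k < n) w k * g (z k).
Proof.
move=> w0 w1; pose c k := NngNum (w0 k).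
pose nu : {measure set R -> \bar R} :=
  msum (fun k => mscale (c k) (\d_(z k) : {measure set R -> \bar R})) n.
have nuint (f : R -> \bar R) : measurable_fun setT f -> (forall x, 0 <= f x)%E ->
    (\int[nu]_x f x = \sum_(k < n) (w k)%:E * f (z k))%E.
  move=> mf f0; rewrite ge0_integral_measure_sum //; apply: eq_bigr => k _.
  by rewrite ge0_integral_mscale //= integral_dirac //= diracT mul1e.
have nu1 : nu setT = 1%E.
  rewrite /nu /= /msum -[RHS]/(1%:E) -w1 -sumEFin; apply: eq_bigr => k _.
  by rewrite -[LHS]/((w k)%:E * \d_(z k) [set: R])%E diracT mule1.
pose mixin := Measure_isProbability.Build _ _ _ nu nu1.
pose P : probability R R := HB.pack (nu : set R -> \bar R) nu mixin.
exists P => g mg.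
have mEg : measurable_fun setT (EFin \o g) by apply/measurable_EFinP.
have ge : P.-integrable setT (EFin \o g).
  apply/integrableP; split => //.
  rewrite [X in (X < _)%E](nuint (fun x => `|(g x)%:E|)%E) //; last first.
    exact: measurableT_comp.
  by under eq_bigr do rewrite -EFinM; rewrite sumEFin ltry.
split=> //; rewrite /Rintegral integralE.
rewrite [X in (X - _)%E](nuint (fun x => (EFin \o g)^\+ x)%E) //; last first.
  exact: measurable_funepos.
rewrite [X in (_ - X)%E](nuint (fun x => (EFin \o g)^\- x)%E) //; last first.
  exact: measurable_funeneg.
under eq_bigr do rewrite funeposE /= -EFin_max -EFinM.
under [in X in (_ - X)%E]eq_bigr do rewrite funenegE /= -EFin_max -EFinM.
rewrite !sumEFin -EFinB /= -sumrB; apply: eq_bigr => k _.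
rewrite -mulrBr; congr (_ * _).
have [g0|/ltW g0] := leP 0 (g (z k)).
  by rewrite max_r ?subr0 // oppr_le0.
by rewrite max_l ?oppr_ge0 // sub0r opprK.
Qed.

End FiniteMixture.

(* Some true is the start state, Some false pays a random reward, None is the sink *)
Definition next_state (x : option bool) : option bool :=
  if x is Some true then Some false else None.

Definition chain_reward {R : realType} (r : R) (x : option bool) (w : R) : R :=
  match x with Some true => r | Some false => w | None => 0 end.

Definition reward_law {R : realType} (P : probability R R) (r : R) (x : option bool) :
    probability R R :=
  match x with Some true => \d_r | Some false => P | None => \d_(0 : R) end.

(** The sample space is the real line with law [P]: the sample point itself is the random reward,
    while states and actions are deterministic. *)
Definition chain_realization {R : realType} (P : probability R R) (r : R)
    (x : option bool) (_ : unit) : realization R (option bool) unit :=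
  @Realization R (option bool) unit _ R P (fun t _ => iter t next_state x)
    (fun _ _ => tt) (fun t => chain_reward r (iter t next_state x)).

Section Chain.
Variables (R : realType) (P : probability R R) (r : R).

Definition chain_kernel (x : option bool) (_ : unit) (y : option bool) : R :=
  (y == next_state x)%:R.

Definition chain_policy (_ : option bool) (_ : unit) : R := 1.

Lemma set_propE (T : Type) (Q : Prop) : [set _ : T | Q] = if `[< Q >] then setT else set0.
Proof.
by case: asboolP => q; apply/seteqP; split.
Qed.

Lemma measurable_prop d (T : measurableType d) (Q : Prop) : measurable [set _ : T | Q].
Proof. by rewrite set_propE; case: ifP. Qed.

Lemma measure_prop (Q : Prop) : P [set _ : R | Q] = `[< Q >]%:R%:E.
Proof. by rewrite set_propE; case: ifP => _; rewrite ?probability_setT ?measure0. Qed.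

Lemma measurable_chain_reward x : measurable_fun setT (chain_reward r x).
Proof.
by case: x => [[]|] /=; [exact: measurable_cst|exact: measurable_id|exact: measurable_cst].
Qed.

Lemma chain_reward_law x (B : set R) : measurable B ->
  P (chain_reward r x @^-1` B) = reward_law P r x B.
Proof.
move=> mB; have cstE (s : R) : P [set _ | B s] = \d_s B.
  by rewrite measure_prop diracE; congr (_%:R%:E); apply/asboolP/idP; rewrite inE.
by case: x => [[]|] //; exact: cstE.
Qed.

(** An event that does not depend on the sample point is empty or everything, hence independent of
    [S]. *)
Lemma measure_prop_setI (Q : Prop) (S : set R) :
  P ([set _ | Q] `&` S) = (P [set _ | Q] * P S)%E.
Proof.
rewrite measure_prop set_propE; case: ifP => _.
  by rewrite setTI mul1e.
by rewrite set0I mul0e measure0.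
Qed.

Lemma bigcap_leqS (T : Type) (F : nat -> set T) n :
  \bigcap_(t in [set t | (t <= n.+1)%N]) F t =
  (\bigcap_(t in [set t | (t <= n)%N]) F t) `&` F n.+1.
Proof.
apply/seteqP; split => [w h|w [h hn] t /=].
  by split; [move=> t /= tn; apply: h; apply: leqW | apply: h => /=].
by rewrite leq_eqVlt => /orP[/eqP -> //|]; rewrite ltnS => ?; apply: h.
Qed.

(** Induction on the horizon: at most one reward depends on the sample point, so one more time step
    multiplies the measure of the cylinder by the new factor. *)
Lemma chain_trajectory x a :
  is_trajectory chain_kernel chain_policy (fun x _ => reward_law P r x) x a
    (chain_realization P r x a).
Proof.
split; first by move=> t y; exact: (@measurable_prop _ R (iter t next_state x = y)).
split; first by move=> t b; exact: (@measurable_prop _ R (tt = b)).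
split; first by move=> t; exact: measurable_chain_reward.
case: a => n xs as_ Bs mB.
have ast t : as_ t = tt by case: (as_ t).
pose E t : set R := [set w | iter t next_state x = xs t /\ tt = as_ t /\
  Bs t (chain_reward r (iter t next_state x) w)].
rewrite -[LHS]/(P (\bigcap_(t in [set t | (t <= n)%N]) E t)).
have E0 t : iter t next_state x <> xs t -> E t = set0.
  by move=> h; apply/seteqP; split => // w [].
have E1 t : iter t next_state x = xs t ->
    E t = chain_reward r (iter t next_state x) @^-1` Bs t.
  by move=> h; apply/seteqP; split => w; [by case=> _ [] | by move=> Bw; rewrite /E /= ast].
have fin (Q : probability R R) (S : set R) : measurable S -> Q S = (fine (Q S))%:E.
  by move=> mS; rewrite fineK // fin_num_measure.
elim: n => [|n IH].
  rewrite /cyl_prob big_ord0 mulr1 ast eqxx mulr1.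
  rewrite (_ : \bigcap_(t in _) _ = E 0%N); last first.
    apply/seteqP; split=> [w h|w Ew t /=]; first exact: h.
    by rewrite leqn0 => /eqP ->.
  have [e|ne] := eqVneq (xs 0%N) x; last first.
    by rewrite E0 ?measure0 ?mul0r // => /esym /eqP; rewrite (negbTE ne).
  by rewrite E1 // /= e mul1r chain_reward_law // -fin.
rewrite bigcap_leqS.
set D := \bigcap_(t in _) _ in IH *.
have -> : cyl_prob chain_kernel chain_policy (fun x _ => reward_law P r x) x tt n.+1 xs as_ Bs =
   cyl_prob chain_kernel chain_policy (fun x _ => reward_law P r x) x tt n xs as_ Bs *
   ((xs n.+1 == next_state (xs n))%:R * fine (reward_law P r (xs n.+1) (Bs n.+1))).
  rewrite /cyl_prob big_ord_recr /= /chain_kernel /chain_policy; ring.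
rewrite EFinM -IH.
(* A prescribed path that leaves the deterministic one makes both sides zero. *)
have [e|ne] := pselect (iter n next_state x = xs n); last first.
  suff -> : D = set0 by rewrite set0I measure0 mul0e.
  by apply/seteqP; split=> // w /(_ n (leqnn n)); rewrite E0.
have [eS|neS] := pselect (iter n.+1 next_state x = xs n.+1); last first.
  rewrite E0 // setI0 measure0 -e (_ : _ == _ = false) ?mul0r ?mule0 //.
  by apply/eqP => h; apply: neS; rewrite h.
rewrite E1 // -eS -e /= eqxx mul1r -fin // -chain_reward_law //.
(* only the reward of [Some false] is random, and [Some false] is entered only at the first step *)
case ex: (iter n next_state x) => [[]|] /=; last first.
- by rewrite setIC muleC; exact: (@measure_prop_setI (Bs n.+1 0)).
- by rewrite setIC muleC; exact: (@measure_prop_setI (Bs n.+1 0)).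
have n0 : n = 0%N by case: (n) ex => // k /=; case: (iter k _ _) => [[]|].
suff -> : D = [set _ | Bs 0%N r] by exact: (@measure_prop_setI (Bs 0%N r)).
rewrite n0 /= in ex e.
apply/seteqP; split=> [w Dw|w Bw t /=].
  by have := Dw 0%N (leq0n n); rewrite E1 //= ex.
by rewrite n0 leqn0 => /eqP ->; rewrite E1 //= ex.
Qed.

(** Two rewards are enough: from time 2 on the chain is in the sink. *)
Definition chain_return (gamma : R) (x : option bool) (w : R) : R :=
  chain_reward r x w + gamma * chain_reward r (next_state x) w.

Lemma chain_partial_return gamma x a (w : R) n :
  partial_return gamma (chain_realization P r x a) w n.+2 = chain_return gamma x w.
Proof.
rewrite /partial_return 2!big_ord_recl big1 => [|i _].
  by rewrite /= expr0 mul1r expr1 addr0.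
have next2 y : next_state (next_state y) = None by case: y => [[]|].
by rewrite /= next2 mulr0.
Qed.

Lemma chain_partial_return_cvg gamma x a (w : R) :
  partial_return gamma (chain_realization P r x a) w @ \oo --> chain_return gamma x w.
Proof.
rewrite -(cvg_shiftn 2) /=; apply: cvg_near_cst; near=> n.
by rewrite addn2 chain_partial_return.
Unshelve. all: by end_near. Qed.

Lemma chain_return_rv gamma x a :
  return_rv gamma (chain_realization P r x a) = chain_return gamma x.
Proof.
apply/funext => w; apply: cvg_lim => //; exact: chain_partial_return_cvg.
Qed.

Lemma measurable_chain_return gamma x : measurable_fun setT (chain_return gamma x).
Proof.
apply: measurable_funD; first exact: measurable_chain_reward.
by apply: measurable_funM; [exact: measurable_cst | exact: measurable_chain_reward].
Qed.

End Chain.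

(** * Consequences of Bellman closedness *)

Section Bellman.
Variables (R : realType) (K : nat) (h : 'I_K -> R -> R).
Hypothesis mh : forall k, measurable_fun setT (h k).
Hypothesis closed_h : bellman_closed h.

(** Stands in for finite support: returns are measurable functions of the sample point, so each
    [h k] of them is integrable. *)
Definition all_integrable (P : probability R R) : Prop :=
  forall g : R -> R, measurable_fun setT g -> P.-integrable setT (EFin \o g).

(** From [Some true] the first reward is [r] and the next return has law [P], so the joint law is a
    point mass at [r] and the statistics of [P]. Laws with equal statistics give [G] the same
    argument, and its value is the statistics of [r + gamma * w]. *)
Lemma bellman_affine (P Q : probability R R) (r gamma : R) :
  0 <= gamma < 1 -> all_integrable P -> all_integrable Q ->
  (forall k, Rintegral P setT (h k) = Rintegral Q setT (h k)) ->
  forall k, Rintegral P setT (fun w => h k (r + gamma * w)) =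
            Rintegral Q setT (fun w => h k (r + gamma * w)).
Proof.
move=> gamma01 iP iQ hPQ.
have [G hG] := closed_h gamma01.
have kernelP x (a : unit) : stochastic_row (@chain_kernel R x a).
  split=> [t|]; first by rewrite /chain_kernel ler0n.
  rewrite (bigD1 (next_state x)) //= /chain_kernel eqxx big1 ?addr0 // => y.
  by move/negbTE ->.
have policyP x : stochastic_row (@chain_policy R x).
  split=> [t|]; first by rewrite /chain_policy ler01.
  by rewrite (bigD1 tt) //= /chain_policy big1 ?addr0 // => -[].
have statE (L : probability R R) x a k :
    stat_of_return gamma h (chain_realization L r x a) k =
    Rintegral L setT (fun w => h k (chain_return r gamma x w)).
  by rewrite /stat_of_return chain_return_rv.
(* The argument of [G] is this point mass on rectangles, with the default 0 of [joint_law] on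
   nonmeasurable ones. *)
have bell (L : probability R R) : all_integrable L ->
    (fun k => Rintegral L setT (fun w => h k (r + gamma * w))) =
    G (fun B0 Bs => if `[< measurable B0 /\ forall k, measurable (Bs k) >] then
         `[< B0 r /\ forall k, Bs k (Rintegral L setT (h k)) >]%:R else 0).
  move=> iL.
  have cvgL x a : return_converges gamma (chain_realization L r x a).
    apply: aeW => w; apply/cvg_ex.
    by exists (chain_return r gamma x w); exact: chain_partial_return_cvg.
  have intL x a k : L.-integrable setT
      (fun w => (h k (return_rv gamma (chain_realization L r x a) w))%:E).
    rewrite chain_return_rv.
    apply: (iL (fun w => h k (chain_return r gamma x w))).
    exact: measurableT_comp (mh k) (measurable_chain_return r gamma x).
  have e := hG _ _ _ _ _ kernelP policyP (chain_realization L r)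
    (fun x a => chain_trajectory L r x a) cvgL intL (Some true) tt.
  refine (etrans (etrans (esym (funext (statE L (Some true) tt))) e) _).
  congr G; apply/funext => B0; apply/funext => Bs; rewrite /joint_law.
  case: ifP => // _.
  rewrite -[X in fine X]/(L [set _ : R | B0 r /\ forall k,
    Bs k (stat_of_return gamma h (chain_realization L r (Some false) tt) k)]).
  rewrite measure_prop /=; congr ((nat_of_bool _)%:R); apply: asbool_equiv_eq.
  have sE k : stat_of_return gamma h (chain_realization L r (Some false) tt) k =
      Rintegral L setT (h k).
    rewrite statE; congr Rintegral; apply/funext => w.
    by rewrite /chain_return /= mulr0 addr0.
  by split=> -[B0r BV]; split=> // k; have := BV k; rewrite sE.
move=> k; set I := fun L : probability R R =>
  (fun k => Rintegral L setT (fun w => h k (r + gamma * w))).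
suff /(congr1 (fun f => f k)) : I P = I Q by [].
rewrite /I bell // bell //; congr G; apply/funext => B0; apply/funext => Bs.
case: ifP => // _; congr ((nat_of_bool _)%:R); apply: asbool_equiv_eq.
by split=> -[B0r BV]; split=> // k'; have := BV k'; rewrite hPQ.
Qed.

(** The constant coordinate makes the weights of a linear relation sum to zero, as for a difference
    of probability vectors. *)
Definition stat_vec (x : R) : 'rV[R]_K.+1 :=
  \row_i (if unlift ord0 i is Some k then h k x else 1).

(** Up to scale, the weights of a relation are the difference of two probability vectors, whose laws
    on the points [z i] share all statistics; [bellman_affine] compares them after the affine
    map. *)
Lemma bellman_relations (r gamma : R) : 0 < gamma < 1 ->
  preserves_relations stat_vec (fun x => r + gamma * x).
Proof.
move=> /andP[g0 g1] [|m] c z; first by rewrite !big_ord0.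
move=> rel; have relj j : \sum_i c i * stat_vec (z i) 0 j = 0.
  have := congr1 (fun v : 'rV_K.+1 => v 0 j) rel; rewrite summxE mxE => e.
  by rewrite -[RHS]e; apply: eq_bigr => i _; rewrite [RHS]mxE.
have c0 : \sum_i c i = 0.
  by rewrite -[RHS](relj ord0); apply: eq_bigr => i _; rewrite mxE unlift_none mulr1.
have ch k : \sum_i c i * h k (z i) = 0.
  by rewrite -[RHS](relj (lift ord0 k)); apply: eq_bigr => i _; rewrite mxE liftK.
(* [S] is positive and at least every [|c i|], so the weights [(1 + c i / S) / N] are
   nonnegative. *)
pose S := 1 + \sum_i `|c i|; pose N : R := m.+1%:R.
have S0 : 0 < S by rewrite ltr_pwDl // sumr_ge0 // => i _; exact: normr_ge0.
have N0 : 0 < N by rewrite ltr0n.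
have cS i : `|c i| <= S.
  by rewrite /S (bigD1 i) //= addrCA lerDl addr_ge0 // sumr_ge0 // => j _; exact: normr_ge0.
(* two probability vectors u and v with v - u proportional to c *)
pose u (k : nat) : R := N^-1.
pose v (k : nat) : R := (1 + c (inord k) / S) / N.
have u1 : \sum_(k < m.+1) u k = 1.
  by rewrite sumr_const card_ord -mulr_natr mulVf // gt_eqF.
have vE (g : R -> R) : \sum_(k < m.+1) v k * g (z (inord k)) =
    \sum_(k < m.+1) u k * g (z (inord k)) + (S * N)^-1 * \sum_i c i * g (z i).
  rewrite mulr_sumr -big_split /=; apply: eq_bigr => k _; rewrite /v /u inord_val.
  by field; rewrite !gt_eqF.
have v1 : \sum_(k < m.+1) v k = 1.
  have := vE (fun=> 1); under eq_bigr do rewrite mulr1.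
  under [in X in _ = X + _]eq_bigr do rewrite mulr1.
  under [in X in _ = _ + X]eq_bigr do rewrite mulr1.
  by rewrite u1 c0 mulr0 addr0.
have v0 k : 0 <= v k.
  rewrite /v mulr_ge0 ?invr_ge0 ?(ltW N0) // -lerBlDl sub0r.
  rewrite ler_pdivlMr // mulN1r; have := cS (inord k); rewrite ler_norml => /andP[]; lra.
have u0 k : 0 <= u k by rewrite invr_ge0 ltW.
have [P hP] := finite_mixture (fun k => z (inord k)) u0 u1.
have [Q hQ] := finite_mixture (fun k => z (inord k)) v0 v1.
have PQ (g : R -> R) : measurable_fun setT g ->
    Rintegral Q setT g = Rintegral P setT g + (S * N)^-1 * \sum_i c i * g (z i).
  by move=> mg; rewrite (hP g mg).2 (hQ g mg).2 vE.
have gamma01 : 0 <= gamma < 1 by rewrite ltW.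
have hPQ k : Rintegral P setT (h k) = Rintegral Q setT (h k).
  by rewrite PQ // ch mulr0 addr0.
have affE k : \sum_i c i * h k (r + gamma * z i) = 0.
  have maff : measurable_fun setT (fun w => h k (r + gamma * w)).
    apply: (measurableT_comp (mh k)); apply: measurable_funD; first exact: measurable_cst.
    by apply: measurable_funM; first exact: measurable_cst.
  (* Integrals against [Q] and [P] differ by [(S * N)^-1] times the weighted sum, so their equality
     makes that sum vanish. *)
  have := bellman_affine r gamma01 (fun g mg => (hP g mg).1) (fun g mg => (hQ g mg).1) hPQ k.
  rewrite (PQ _ maff) -{1}[LHS]addr0 => /addrI /esym /eqP.
  by rewrite mulf_eq0 invr_eq0 mulf_eq0 (gt_eqF S0) (gt_eqF N0) => /eqP.
apply/rowP => j; rewrite summxE mxE.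
under eq_bigr do rewrite !mxE.
case: (unlift ord0 j) => [k|]; first exact: affE.
by under eq_bigr do rewrite mulr1.
Qed.

End Bellman.

(** * Spans of statistics and of moments *)

Section Spans.
Variables (R : realType).

Lemma Rintegral_lincomb (mu : probability R R) n (c : 'I_n -> R) (F : 'I_n -> R -> R) :
  (forall i, mu.-integrable setT (EFin \o F i)) ->
  Rintegral mu setT (fun x => \sum_i c i * F i x) = \sum_i c i * Rintegral mu setT (F i).
Proof.
move=> iF.
have iZ i : mu.-integrable setT (EFin \o (fun x => c i * F i x)).
  have := integrableZl measurableT (c i) (iF i).
  by congr (_.-integrable _ _); apply/funext => x /=; rewrite EFinM.
elim: (index_enum _) => [|j s IH].
  rewrite big_nil (_ : (fun _ => _) = cst 0) ?Rintegral_cst ?mul0r //.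
  by apply/funext => x; rewrite big_nil.
rewrite big_cons -IH -(RintegralZl _ measurableT (iF j)) -RintegralD //.
- by congr Rintegral; apply/funext => x; rewrite big_cons.
- have := integrable_sum measurableT s (fun i (_ : true) => iZ i).
  by congr (_.-integrable _ _); apply/funext => x /=; rewrite sumEFin.
Qed.

(** A pointwise identity between integrands integrates to one between functionals, since every [G j]
    is integrable against the laws considered. *)
Lemma fspan_sub (D : Type) (mu : D -> probability R R) m n
    (F : 'I_m -> R -> R) (G : 'I_n -> R -> R) (f : 'I_m -> D -> R) (g : 'I_n -> D -> R) :
  (forall i d, f i d = Rintegral (mu d) setT (F i)) ->
  (forall j d, g j d = Rintegral (mu d) setT (G j)) ->
  (forall j d, (mu d).-integrable setT (EFin \o G j)) ->
  (forall i, exists c : 'I_n -> R, forall x, F i x = \sum_j c j * G j x) ->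
  fspan f `<=` fspan g.
Proof.
move=> fE gE iG /choice [c hc] _ [a ->].
exists (fun j => \sum_i a i * c i j); apply/funext => d.
transitivity (\sum_i a i * \sum_j c i j * g j d).
  apply: eq_bigr => i _; congr (_ * _); rewrite fE (_ : F i = fun x => \sum_j c i j * G j x).
    by rewrite Rintegral_lincomb //; apply: eq_bigr => j _; rewrite gE.
  by apply/funext => x; exact: hc.
under eq_bigr do rewrite mulr_sumr.
rewrite exchange_big /=; apply: eq_bigr => j _.
by rewrite mulr_suml; apply: eq_bigr => i _; rewrite mulrA.
Qed.

End Spans.

Unset Implicit Arguments.

Theorem theorem1 (R : realType) (K : nat) (h : 'I_K -> R -> R) :
  (forall k, measurable_fun setT (h k)) ->
  bellman_closed h ->
  exists L : nat, (L <= K)%N /\ fspan (stat_funs h L) = fspan (moment_funs h L).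
Proof.
move=> mh closed_h.
pose phi := stat_vec h.
have phi0 x : phi x 0 ord0 = 1 by rewrite mxE unlift_none.
have phiS k x : phi x 0 (lift ord0 k) = h k x by rewrite mxE liftK.
have mphi i : measurable_fun setT (fun x => phi x 0 i).
  case: (unliftP ord0 i) => [k|] ->.
    by rewrite (_ : (fun _ => _) = h k) //; apply/funext => x; exact: phiS.
  by rewrite (_ : (fun _ => _) = cst 1) //; apply/funext => x; exact: phi0.
have [polphi actphi] := relations_is_pol mphi (bellman_relations mh closed_h).
(* [L] will be the least common bound on the degrees of the coordinates; [K] is such a bound, since
   there are [K.+1] coordinates. *)
pose P L := `[< forall i, is_pol L.+1 (fun x => phi x 0 i) >].
have PK : exists L, P L by exists K; apply/asboolP.
case: (ex_minnP PK) => L /asboolP PL minL.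
exists L; split; first by apply: minL; apply/asboolP.
have lincomb i : exists c : 'I_L.+1 -> R, forall x, phi x 0 i = \sum_l c l * x ^+ l.
  by have [c hc] := is_polP (PL i); exists (fun l => c l).
pose V : set (R -> R) := [set f | exists a : 'cV[R]_K.+1, forall x, f x = (phi x *m a) 0 0].
have Vlin a f g : V f -> V g -> V (fun x => a * f x + g x).
  move=> [u hu] [v hv]; exists (a *: u + v) => x.
  by rewrite hu hv mulmxDr -scalemxAr [RHS]mxE; congr (_ + _); rewrite [RHS]mxE.
have V0 : V (fun=> 0) by exists 0 => x; rewrite mulmx0 mxE.
have Vshift f : V f -> V (fun x => f (x + 1)).
  move=> [u hu]; have [U hU] := actphi 1 1 ltr01.
  by exists (U *m u) => x; rewrite hu addrC -[X in 1 + X]mul1r hU mulmxA.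
have Vphi i : V (fun x => phi x 0 i).
  by exists (delta_mx i 0) => x; rewrite -colE [RHS]mxE.
have VX : forall l, (l <= L)%N -> V (fun x => x ^+ l).
  (* For [L = 0] the constant coordinate is the only monomial needed; otherwise minimality provides
     a coordinate of degree exactly [L], to which [span_monomials] applies. *)
  case: L PL minL {lincomb} => [|L] PL minL l lL.
    move: lL; rewrite leqn0 => /eqP ->; have := Vphi ord0.
    by congr V; apply/funext => x; rewrite phi0 expr0.
  have [i hi] : exists i, ~ is_pol L.+1 (fun x => phi x 0 i).
    apply/existsNP => h1; have /minL : P L by apply/asboolP.
    by rewrite ltnn.
  have [a ha] : exists a, is_pol L.+1 (fun x => phi x 0 i - a * x ^+ L.+1) := PL i.
  have [a0|a0] := eqVneq a 0.
    by case: hi; apply: (is_pol_ext _ ha) => x; rewrite a0 mul0r subr0.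
  exact: (span_monomials Vlin V0 Vshift (Vphi i) a0 ha).
have statE i (d : stat_dom h L) : stat_funs h L i d =
    Rintegral (sval d) setT (fun x => phi x 0 i).
  rewrite /stat_funs /Rintegral; case: (unliftP ord0 i) => [k|] ->.
    congr fine; apply: eq_integral => x _; by rewrite phiS.
  rewrite (_ : (fun x : R => _) = cst 1%:E); last first.
    by apply/funext => x; rewrite phi0.
  by rewrite integral_cst // mul1e; exact: (congr1 fine (esym (probability_setT (sval d)))).
have iX (l : 'I_L.+1) (d : stat_dom h L) :
    (sval d).-integrable setT (EFin \o (fun x : R => x ^+ l)).
  by case: d => mu /= [_ hX]; apply: hX; rewrite -ltnS.
have iphi i (d : stat_dom h L) : (sval d).-integrable setT (EFin \o (fun x => phi x 0 i)).
  case: (unliftP ord0 i) => [k|] ->.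
    rewrite (_ : (fun x => phi x 0 _) = h k); last by apply/funext => x; exact: phiS.
    by case: d => mu /= [hh _]; exact: hh.
  rewrite (_ : (fun x => phi x 0 _) = (fun x => x ^+ (ord0 : 'I_L.+1))); first exact: iX.
  by apply/funext => x; rewrite phi0 expr0.
apply/seteqP; split.
  exact: (fspan_sub (mu := @sval _ _) statE _ iX lincomb).
apply: (fspan_sub (mu := @sval _ _) (F := fun l x => x ^+ l) _ statE iphi) => // l.
have [|u hu] := VX l; first by rewrite -ltnS.
by exists (fun i => u i 0) => x; rewrite hu mxE; apply: eq_bigr => i _; rewrite mulrC.
Qed.
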